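(* Let $\mathbf{k}$ be a field, $X=\{x_1,\dots,x_n\}$ with $n\ge2$, $f\in\mathrm{Sym}(X)$, let $(X,r_f)$ be the corresponding permutation idempotent solution and $\mathcal{A}=\mathcal{A}(\mathbf{k},X,r_f)$ its Yang-Baxter algebra. For each $d\ge2$, the $d$-Veronese subalgebra $\mathcal{A}^{(d)}$ is isomorphic to the Yang-Baxter algebra of the normalized $d$-Veronese solution $(\mathcal{N}_d,\rho_d)$, which is also a permutation idempotent solution of order $n$.
   Context: A permutation idempotent solution on a set $Y$ is a pair $(Y,r_g)$ with $g\in\mathrm{Sym}(Y)$ and $r_g(x,y)=(g(y),y)$. For a finite set-theoretic solution $(X,r)$ of the Yang-Baxter equation, the Yang-Baxter algebra is $\mathcal{A}(\mathbf{k},X,r)=\mathbf{k}\langle X\rangle/(xy-y'x'\mid r(x,y)=(y',x'))$, graded by word length. For a graded algebra $A=\bigoplus_{m\ge0}A_m$ the $d$-Veronese subalgebra is $A^{(d)}=\bigoplus_{m\ge0}A_{md}$. Write $r(x,y)=({}^xy,x^y)$. The associated monoid is $S=S(X,r)=\langle X\mid xy=y'x'\text{ whenever }r(x,y)=(y',x')\rangle$, graded by word length $|\cdot|$. It is known that the actions $(x,y)\mapsto{}^xy$, $(x,y)\mapsto x^y$ on $X$ extend uniquely to maps $S\times S\to S$, $(a,b)\mapsto{}^ab$, $(a,b)\mapsto a^b$, satisfying, for all $a,b,u,v\in S$: ${}^a1=1$, ${}^1u=u$, $1^u=1$, $a^1=a$; ${}^{(ab)}u={}^a({}^bu)$; $a^{(uv)}=(a^u)^v$;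 ${}^a(uv)=({}^au)({}^{a^u}v)$; $(ab)^u=(a^{{}^bu})(b^u)$; $({}^uv)(u^v)=uv$; and $|{}^au|=|u|=|u^a|$. Fix the degree-lexicographic order on words with $x_1<\dots<x_n$. Normal words are the words minimal in this order among all words representing the same element of $S$; $\mathrm{Nor}(u)$ is the unique normal word equal in $S$ to $u$; $\mathcal{N}_d$ is the set of normal words of length $d$ (for $r=r_f$, $\mathcal{N}_d=\{x_1^{d-1}x_q\mid1\le q\le n\}$). The normalized $d$-Veronese solution associated to $(X,r)$ is $(\mathcal{N}_d,\rho_d)$ with $\rho_d(a,b)=(\mathrm{Nor}({}^ab),\mathrm{Nor}(a^b))$ for $a,b\in\mathcal{N}_d$. *)

(* Defs.v *)
From HB Require Import structures.
From mathcomp Require Import all_boot all_order all_algebra all_fingroup.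
From mathcomp Require Import generic_quotient ring_quotient finmap boolp.
From mathcomp.multinomials Require Import monalg.

(* Congruences and ideals are propositions; [asbool] turns them into the boolean
   relations expected by generic quotients. *)

Set Implicit Arguments.
Unset Strict Implicit.
Unset Printing Implicit Defensive.

Import GRing.Theory.

Local Open Scope quotient_scope.
Local Open Scope group_scope.
Local Open Scope ring_scope.

Section QuadraticMaps.
Variable X : finType.
Implicit Types r : X * X -> X * X.

(* A map r is written r(x,y) = (^x y, x^y); [map12 r] is r x id and [map23 r] is
   id x r. *)
Definition map12 r (t : X * X * X) : X * X * X :=
  let: (x, y, z) := t in let: (y', x') := r (x, y) in (y', x', z).

Definition map23 r (t : X * X * X) : X * X * X :=
  let: (x, y, z) := t in let: (z', y') := r (y, z) in (x, z', y').

Definition yang_baxter r :=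
  forall t, map12 r (map23 r (map12 r t)) = map23 r (map12 r (map23 r t)).

Record solution := Solution {
  solution_map :> X * X -> X * X;
  solution_ybe : yang_baxter solution_map
}.

Definition perm_idempotent_map (g : {perm X}) (p : X * X) : X * X :=
  (g p.2, p.2).

Lemma perm_idempotent_ybe g : yang_baxter (perm_idempotent_map g).
Proof. by move=> [[x y] z]. Qed.

Definition perm_idempotent_solution g : solution :=
  Solution (perm_idempotent_ybe g).

Definition is_perm_idempotent r :=
  exists g : {perm X}, r =1 perm_idempotent_map g.

End QuadraticMaps.

Section AssociatedMonoid.
Variables (X : finType) (r : X * X -> X * X).
Implicit Types (u v w : seq X) (x y z : X).

(* The congruence on the free monoid of words generated by x y = y' x' whenever
   r(x,y) = (y',x'). *)
Inductive word_cong : seq X -> seq X -> Prop :=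
| word_cong_refl u : word_cong u u
| word_cong_sym u v : word_cong u v -> word_cong v u
| word_cong_trans v u w : word_cong u v -> word_cong v w -> word_cong u w
| word_cong_rel u v x y :
    word_cong (u ++ [:: x; y] ++ v)
              (u ++ [:: (r (x, y)).1; (r (x, y)).2] ++ v).

Lemma word_cong_size u v : word_cong u v -> size u = size v.
Proof.
by elim=> // {u v}[u v w _ -> _ -> //|u v x y]; rewrite !size_cat.
Qed.

Lemma word_cong_catr w u v : word_cong u v -> word_cong (u ++ w) (v ++ w).
Proof.
elim=> {u v} [u|u v _|v u z _ IH1 _ IH2|u v x y].
- exact: word_cong_refl.
- exact: word_cong_sym.
- exact: word_cong_trans IH1 IH2.
- by rewrite -!catA; apply: word_cong_rel.
Qed.

Lemma word_cong_catl w u v : word_cong u v -> word_cong (w ++ u) (w ++ v).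
Proof.
elim=> {u v} [u|u v _|v u z _ IH1 _ IH2|u v x y].
- exact: word_cong_refl.
- exact: word_cong_sym.
- exact: word_cong_trans IH1 IH2.
- by rewrite !(catA w); apply: word_cong_rel.
Qed.

Lemma word_cong_cat u v u' v' :
  word_cong u u' -> word_cong v v' -> word_cong (u ++ v) (u' ++ v').
Proof.
move=> cu cv; apply: word_cong_trans (word_cong_catl u' cv).
exact: word_cong_catr.
Qed.

Definition word_congb u v : bool := `[< word_cong u v >].

Lemma word_congb_equiv : equiv_class_of word_congb.
Proof.
split=> [u|u v|v u w].
- by apply/asboolP; apply: word_cong_refl.
- by apply/asboolP/asboolP; apply: word_cong_sym.
- by move=> /asboolP uv /asboolP vw; apply/asboolP; apply: word_cong_trans vw.
Qed.

Canonical word_congb_equivRel := EquivRelPack word_congb_equiv.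

Definition yb_monoid := {eq_quot word_congb}.

HB.instance Definition _ := Choice.on yb_monoid.
HB.instance Definition _ : EqQuotient (seq X) word_congb yb_monoid :=
  EqQuotient.on yb_monoid.

Definition word_class u : yb_monoid := \pi_yb_monoid u.

Lemma word_classP u v : word_class u = word_class v <-> word_cong u v.
Proof.
split; first by move/eqP; rewrite /word_class piE => /asboolP.
by move=> uv; apply/eqP; rewrite /word_class piE; apply/asboolP.
Qed.

Lemma word_class_repr (a : yb_monoid) : word_class (repr a) = a.
Proof. exact: reprK. Qed.

Lemma word_cong_repr u : word_cong (repr (word_class u)) u.
Proof. by apply/word_classP; rewrite word_class_repr. Qed.

Definition yb_monoid_one : yb_monoid := word_class [::].
Definition yb_monoid_mul (a b : yb_monoid) : yb_monoid :=
  word_class (repr a ++ repr b).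

Lemma yb_monoid_mulE u v :
  yb_monoid_mul (word_class u) (word_class v) = word_class (u ++ v).
Proof. by apply/word_classP; apply: word_cong_cat; apply: word_cong_repr. Qed.

Lemma yb_monoid_mulA : associative yb_monoid_mul.
Proof.
move=> a b c; rewrite -[a]word_class_repr -[b]word_class_repr.
by rewrite -[c]word_class_repr !yb_monoid_mulE catA.
Qed.

Lemma yb_monoid_mul1g : left_id yb_monoid_one yb_monoid_mul.
Proof. by move=> a; rewrite -[a]word_class_repr yb_monoid_mulE. Qed.

Lemma yb_monoid_mulg1 : right_id yb_monoid_one yb_monoid_mul.
Proof. by move=> a; rewrite -[a]word_class_repr yb_monoid_mulE cats0. Qed.

HB.instance Definition _ := isMonoid.Build yb_monoid
  yb_monoid_mulA yb_monoid_mul1g yb_monoid_mulg1.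

Lemma word_class1 : word_class [::] = 1%g.
Proof. by []. Qed.

Lemma word_classM u v : word_class (u ++ v) = (word_class u * word_class v)%g.
Proof. by rewrite -yb_monoid_mulE. Qed.

Definition yb_degree (a : yb_monoid) : nat := size (repr a).

Lemma yb_degree_class u : yb_degree (word_class u) = size u.
Proof. exact/word_cong_size/word_cong_repr. Qed.

(* [lact a u] and [ract a u] stand for ^a u and a^u. For a solution of the
   Yang-Baxter equation this extension of r to the associated monoid exists
   ([solution_actions]) and is unique ([monoid_actions_unique]). *)
Record monoid_actions := MonoidActions {
  lact : yb_monoid -> yb_monoid -> yb_monoid;
  ract : yb_monoid -> yb_monoid -> yb_monoid;
  lact_letter : forall x y,
    lact (word_class [:: x]) (word_class [:: y]) = word_class [:: (r (x, y)).1];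
  ract_letter : forall x y,
    ract (word_class [:: x]) (word_class [:: y]) = word_class [:: (r (x, y)).2];
  lact_g1 : forall a : yb_monoid, lact a 1%g = 1%g;
  lact_1g : forall u : yb_monoid, lact 1%g u = u;
  ract_1g : forall u : yb_monoid, ract 1%g u = 1%g;
  ract_g1 : forall a : yb_monoid, ract a 1%g = a;
  lact_actM : forall a b u : yb_monoid, lact (a * b)%g u = lact a (lact b u);
  ract_actM : forall a u v : yb_monoid, ract a (u * v)%g = ract (ract a u) v;
  lact_M : forall a u v : yb_monoid, lact a (u * v)%g = (lact a u * lact (ract a u) v)%g;
  ract_M : forall a b u : yb_monoid, ract (a * b)%g u = (ract a (lact b u) * ract b u)%g;
  lact_ract : forall u v : yb_monoid, (lact u v * ract u v)%g = (u * v)%g;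
  lact_degree : forall a u : yb_monoid, yb_degree (lact a u) = yb_degree u;
  ract_degree : forall a u : yb_monoid, yb_degree (ract u a) = yb_degree u
}.

Lemma monoid_actions_unique (A B : monoid_actions) :
  lact A =2 lact B /\ ract A =2 ract B.
Proof.
have letter x v : lact A (word_class [:: x]) (word_class v) =
                  lact B (word_class [:: x]) (word_class v) /\
                  ract A (word_class [:: x]) (word_class v) =
                  ract B (word_class [:: x]) (word_class v).
  elim: v x => [|y v IHv] x; first by rewrite !word_class1 !lact_g1 !ract_g1.
  rewrite -[y :: v]cat1s word_classM !lact_M !ract_actM !lact_letter.
  by rewrite !ract_letter; have [-> ->] := IHv (r (x, y)).2.
have words u v : lact A (word_class u) (word_class v) =
                 lact B (word_class u) (word_class v) /\
                 ract A (word_class u) (word_class v) =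
                 ract B (word_class u) (word_class v).
  elim: u v => [|x u IHu] v; first by rewrite !word_class1 !lact_1g !ract_1g.
  rewrite -[x :: u]cat1s word_classM !lact_actM !ract_M.
  have [-> ->] := IHu v.
  rewrite -[lact B _ _]word_class_repr.
  by have [-> ->] := letter x (repr (lact B (word_class u) (word_class v))).
by split=> a b; rewrite -[a]word_class_repr -[b]word_class_repr;
   case: (words (repr a) (repr b)).
Qed.

End AssociatedMonoid.

Section Actions.
Variables (X : finType) (s : solution X).
Implicit Types (a b u v w : seq X) (x y z : X).

Local Notation L x y := (s (x, y)).1.
Local Notation R x y := (s (x, y)).2.

Lemma solution_eqs x y z :
  [/\ L (L x y) (L (R x y) z) = L x (L y z),
      R (L x y) (L (R x y) z) = L (R x (L y z)) (R y z) &
      R (R x y) z = R (R x (L y z)) (R y z)].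
Proof.
have := solution_ybe s (x, y, z); rewrite /map12 /map23.
case: (s (x, y)) => [x1 y1]; case: (s (y, z)) => [y2 z2] /=.
case: (s (y1, z)) => [y3 z3]; case: (s (x, y2)) => [x4 y4] /=.
by case: (s (x1, y3)) => ? ?; case: (s (y4, z2)) => ? ? [-> -> ->].
Qed.

Fixpoint wlact1 x u := if u is y :: u' then L x y :: wlact1 (R x y) u' else [::].
Definition wract1 x u := foldl (fun x' y => R x' y) x u.
Definition wlact a u := foldr wlact1 u a.
Fixpoint wract a u :=
  if a is x :: a' then wract1 x (wlact a' u) :: wract a' u else [::].

Lemma wlact1_cat x u v : wlact1 x (u ++ v) = wlact1 x u ++ wlact1 (wract1 x u) v.
Proof. by elim: u x => //= y u IHu x; rewrite IHu. Qed.

Lemma wract1_cat x u v : wract1 x (u ++ v) = wract1 (wract1 x u) v.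
Proof. exact: foldl_cat. Qed.

Lemma wlact_catl a b u : wlact (a ++ b) u = wlact a (wlact b u).
Proof. exact: foldr_cat. Qed.

Lemma wract_catl a b u : wract (a ++ b) u = wract a (wlact b u) ++ wract b u.
Proof. by elim: a => //= x a ->; rewrite wlact_catl. Qed.

Lemma wlact_catr a u v : wlact a (u ++ v) = wlact a u ++ wlact (wract a u) v.
Proof. by elim: a => //= x a ->; rewrite wlact1_cat. Qed.

Lemma wract_catr a u v : wract a (u ++ v) = wract (wract a u) v.
Proof. by elim: a => //= x a ->; rewrite wlact_catr wract1_cat. Qed.

Lemma size_wlact a u : size (wlact a u) = size u.
Proof.
have size1 x v : size (wlact1 x v) = size v.
  by elim: v x => //= y v IHv x; rewrite IHv.
by elim: a => //= x a IHa; rewrite size1.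
Qed.

Lemma size_wract a u : size (wract a u) = size a.
Proof. by elim: a => //= x a ->. Qed.

Lemma wlact_nil a : wlact a [::] = [::].
Proof. by elim: a => //= x a ->. Qed.

Lemma wract_nil a : wract a [::] = a.
Proof. by elim: a => //= x a ->; rewrite wlact_nil. Qed.

Local Notation cong := (word_cong s).

Lemma wlact_wract u v : cong (wlact u v ++ wract u v) (u ++ v).
Proof.
have letter x w : cong (wlact1 x w ++ [:: wract1 x w]) (x :: w).
  elim: w x => [|y w IHw] x /=; first exact: word_cong_refl.
  apply: word_cong_trans (word_cong_catl [:: L x y] (IHw (R x y))) _.
  exact/word_cong_sym/(word_cong_rel _ [::] w x y).
elim: u => [|x u IHu] /=; first by rewrite cats0; apply: word_cong_refl.
rewrite -cat1s catA.
apply: word_cong_trans (word_cong_catr _ (letter _ _)) _.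
exact: (word_cong_catl [:: x] IHu).
Qed.

Lemma wact_congr a u v :
  cong u v -> cong (wlact a u) (wlact a v) /\ wract a u = wract a v.
Proof.
have letter x w w' : cong w w' ->
    cong (wlact1 x w) (wlact1 x w') /\ wract1 x w = wract1 x w'.
  move=> ww'; elim: ww' x => {w w'} [w|w w' _ IH|w' w w'' _ IH1 _ IH2|w w' y z] x.
  - by split=> //; apply: word_cong_refl.
  - by have [? ->] := IH x; split=> //; apply: word_cong_sym.
  - have [? ->] := IH1 x; have [? ->] := IH2 x; split=> //.
    by apply: word_cong_trans; eassumption.
  - rewrite !wlact1_cat !wract1_cat /=.
    have [E1 E2 E3] := solution_eqs (wract1 x w) y z.
    split; last by rewrite E3.
    rewrite E3 -E2 -E1; exact: word_cong_rel.
move=> uv; elim: a => //= x a [IH1 ->].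
by have [? ->] := letter x _ _ IH1.
Qed.

Lemma wact_congl a b u :
  cong a b -> wlact a u = wlact b u /\ cong (wract a u) (wract b u).
Proof.
have pair x y w : wlact [:: x; y] w = wlact [:: L x y; R x y] w /\
    wract [:: L x y; R x y] w =
    [:: L (wract1 x (wlact1 y w)) (wract1 y w);
        R (wract1 x (wlact1 y w)) (wract1 y w)].
  elim: w x y => [//|z w IHw] x y /=.
  have [E1 E2 E3] := solution_eqs x y z.
  have /= [IH1 IH2] := IHw (R x (L y z)) (R y z).
  by rewrite E1 E2 E3 IH1.
elim=> {a b} [a|a b _ [-> ?]|b a c _ [-> ?] _ [-> ?]|a b x y].
- by split=> //; apply: word_cong_refl.
- by split=> //; apply: word_cong_sym.
- by split=> //; apply: word_cong_trans; eassumption.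
- have [E1 E2] := pair x y (wlact b u).
  rewrite !wlact_catl !wract_catl !wlact_catl E1; split=> //.
  by rewrite E2; apply: word_cong_rel.
Qed.

Local Notation cl := (word_class s).

Definition solution_lact (a u : yb_monoid s) := cl (wlact (repr a) (repr u)).
Definition solution_ract (a u : yb_monoid s) := cl (wract (repr a) (repr u)).

Lemma solution_lactE a u : solution_lact (cl a) (cl u) = cl (wlact a u).
Proof.
apply/word_classP; have [-> _] := wact_congl (repr (cl u)) (word_cong_repr s a).
by have [] := wact_congr a (word_cong_repr s u).
Qed.

Lemma solution_ractE a u : solution_ract (cl a) (cl u) = cl (wract a u).
Proof.
apply/word_classP.
have [_ H] := wact_congl (repr (cl u)) (word_cong_repr s a).
by apply: word_cong_trans H _; have [_ ->] := wact_congr a (word_cong_repr s u);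
   apply: word_cong_refl.
Qed.

Lemma yb_monoid_ind (P : yb_monoid s -> Prop) : 
  (forall u, P (cl u)) -> forall a : yb_monoid s, P a.
Proof. by move=> Pcl a; rewrite -[a]word_class_repr. Qed.

Definition solution_actions : monoid_actions s.
Proof.
have E := (solution_lactE, solution_ractE).
exists solution_lact solution_ract.
- by move=> x y; rewrite !E.
- by move=> x y; rewrite !E.
- by elim/yb_monoid_ind=> a; rewrite -word_class1 !E wlact_nil.
- by elim/yb_monoid_ind=> a; rewrite -word_class1 !E.
- by elim/yb_monoid_ind=> a; rewrite -word_class1 !E.
- by elim/yb_monoid_ind=> a; rewrite -word_class1 !E wract_nil.
- elim/yb_monoid_ind=> a; elim/yb_monoid_ind=> b; elim/yb_monoid_ind=> u.
  by rewrite -word_classM !E wlact_catl.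
- elim/yb_monoid_ind=> a; elim/yb_monoid_ind=> u; elim/yb_monoid_ind=> v.
  by rewrite -word_classM !E wract_catr.
- elim/yb_monoid_ind=> a; elim/yb_monoid_ind=> u; elim/yb_monoid_ind=> v.
  by rewrite -word_classM !E wlact_catr word_classM.
- elim/yb_monoid_ind=> a; elim/yb_monoid_ind=> b; elim/yb_monoid_ind=> u.
  by rewrite -word_classM !E wract_catl word_classM.
- elim/yb_monoid_ind=> u; elim/yb_monoid_ind=> v.
  by rewrite !E -!word_classM; apply/word_classP; apply: wlact_wract.
- elim/yb_monoid_ind=> a; elim/yb_monoid_ind=> u.
  by rewrite E !yb_degree_class size_wlact.
- elim/yb_monoid_ind=> a; elim/yb_monoid_ind=> u.
  by rewrite E !yb_degree_class size_wract.
Defined.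

End Actions.

Section NormalWords.
Variables (n : nat) (r : 'I_n * 'I_n -> 'I_n * 'I_n).
Implicit Types (u v w : seq 'I_n).

(* The alphabet x_1 < ... < x_n is 'I_n with its usual order. *)
Definition deglex u v : bool :=
  (size u < size v)%N ||
  ((size u == size v) && ((u : seqlexi 'I_n) <= (v : seqlexi 'I_n))%O).

Definition is_normal w : bool :=
  `[< forall v, word_class r v = word_class r w -> deglex w v >].

Lemma normal_form_exists (a : yb_monoid r) :
  exists w, is_normal w && (word_class r w == a).
Proof.
pose d := size (repr a).
pose P (t : d.-tuple 'I_n) := word_class r t == a.
have P0 : P (in_tuple (repr a)) by rewrite /P /= word_class_repr.
pose F (t : d.-tuple 'I_n) : seqlexi 'I_n := tval t.
case: (@Order.TotalTheory.arg_minP _ _ _ _ P F P0) => t Pt tmin.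
have ta : word_class r t = a by apply/eqP.
exists t; rewrite ta eqxx andbT; apply/asboolP => v vt.
have cv : word_class r v = a by rewrite vt.
have sv : size v = d by rewrite -(yb_degree_class r) cv.
rewrite /deglex size_tuple sv ltnn eqxx /=.
have sv' : size v == d by rewrite sv.
by apply: (tmin (Tuple sv')); rewrite /P /= cv.
Qed.

Definition Nor (a : yb_monoid r) : seq 'I_n := xchoose (normal_form_exists a).

Lemma Nor_normal a : is_normal (Nor a).
Proof. by have /andP[] := xchooseP (normal_form_exists a). Qed.

Lemma NorK a : word_class r (Nor a) = a.
Proof. by have /andP[_ /eqP] := xchooseP (normal_form_exists a). Qed.

Lemma Nor_unique w : is_normal w -> Nor (word_class r w) = w.
Proof.
move=> /asboolP nw; have /asboolP nN := Nor_normal (word_class r w).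
have := nN w (esym (NorK _)); have := nw _ (NorK _).
rewrite /deglex; case: ltngtP => //= _ le1 le2.
by apply/(@Order.POrderTheory.le_anti _ (seqlexi 'I_n)); rewrite le1 le2.
Qed.

Lemma size_Nor a : size (Nor a) = yb_degree a.
Proof. by rewrite -(yb_degree_class r) NorK. Qed.

Variable d : nat.

Definition normal_words : finType := {w : d.-tuple 'I_n | is_normal w}.

Definition normal_word_class (a : normal_words) : yb_monoid r :=
  word_class r (val a).

Lemma yb_degree_normal_word a : yb_degree (normal_word_class a) = d.
Proof. by rewrite yb_degree_class size_tuple. Qed.

Lemma size_Nor_eq (a : yb_monoid r) : yb_degree a = d -> size (Nor a) == d.
Proof. by rewrite size_Nor => ->. Qed.

Definition normal_word (a : yb_monoid r) (ad : yb_degree a = d) : normal_words :=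
  exist _ (Tuple (size_Nor_eq ad)) (Nor_normal a).

End NormalWords.

Section VeroneseSolution.
Variables (n : nat) (s : solution 'I_n) (d : nat).
Let act := solution_actions s.
Implicit Types a b : normal_words s d.

Definition veronese_lact a b : yb_monoid s :=
  lact act (normal_word_class a) (normal_word_class b).

Definition veronese_ract a b : yb_monoid s :=
  ract act (normal_word_class a) (normal_word_class b).

Lemma veronese_lact_degree a b : yb_degree (veronese_lact a b) = d.
Proof. by rewrite lact_degree yb_degree_normal_word. Qed.

Lemma veronese_ract_degree a b : yb_degree (veronese_ract a b) = d.
Proof. by rewrite ract_degree yb_degree_normal_word. Qed.

Definition veronese_map (p : normal_words s d * normal_words s d) :
    normal_words s d * normal_words s d :=
  (normal_word (veronese_lact_degree p.1 p.2),
   normal_word (veronese_ract_degree p.1 p.2)).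

End VeroneseSolution.

Arguments veronese_map [n] s d p.

Section YangBaxterAlgebra.
Variables (k : fieldType) (X : finType) (r : X * X -> X * X).

Local Notation free_alg := {malg k[{fmonom X}]}.

Definition free_var (x : X) : free_alg := << fmu x >>.

Definition yb_relation (p : X * X) : free_alg :=
  free_var p.1 * free_var p.2 - free_var (r p).1 * free_var (r p).2.

(* The two-sided ideal generated by the relations. *)
Definition in_yb_ideal (q : free_alg) : Prop :=
  exists t : seq (free_alg * (X * X) * free_alg),
    q = \sum_(c <- t) c.1.1 * yb_relation c.1.2 * c.2.

Definition yb_ideal : {pred free_alg} := fun q => `[< in_yb_ideal q >].

Lemma yb_ideal_zmod_closed : zmod_closed yb_ideal.
Proof.
split; first by apply/asboolP; exists [::]; rewrite big_nil.
move=> p q /asboolP[t ->] /asboolP[t' ->]; apply/asboolP.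
exists (t ++ [seq (- c.1.1, c.1.2, c.2) | c <- t']).
rewrite big_cat big_map /= -sumrN; congr (_ + _).
by apply: eq_bigr => c _; rewrite !mulNr.
Qed.

HB.instance Definition _ :=
  GRing.isZmodClosed.Build free_alg yb_ideal yb_ideal_zmod_closed.

Lemma yb_idealMl p q : q \in yb_ideal -> p * q \in yb_ideal.
Proof.
move=> /asboolP[t ->]; apply/asboolP.
exists [seq (p * c.1.1, c.1.2, c.2) | c <- t].
by rewrite big_map mulr_sumr; apply: eq_bigr => c _; rewrite !mulrA.
Qed.

Lemma yb_idealMr p q : q \in yb_ideal -> q * p \in yb_ideal.
Proof.
move=> /asboolP[t ->]; apply/asboolP.
exists [seq (c.1.1, c.1.2, c.2 * p) | c <- t].
by rewrite big_map mulr_suml; apply: eq_bigr => c _; rewrite -[LHS]mulrA.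
Qed.

Lemma free_alg_scalerAr (c : k) (p q : free_alg) : c *: (p * q) = p * (c *: q).
Proof.
have comm (g : {malg k[{fmonom X}]}) : g * c%:MP = c%:MP * g.
  rewrite [LHS]fgmulgU [RHS]fgmulUg; apply: eq_bigr => w _.
  by rewrite mulrC mulm1 mul1m.
by rewrite -[LHS]mul_malgC -[c *: q]mul_malgC !mulrA -comm.
Qed.

Definition yb_algebra := Quotient.quot yb_ideal.

HB.instance Definition _ := GRing.Zmodule.on yb_algebra.

Definition yb_pi (p : free_alg) : yb_algebra := \pi_(Quotient.quot yb_ideal) p.

Lemma yb_piP p q : yb_pi p = yb_pi q <-> p - q \in yb_ideal.
Proof.
rewrite (Quotient.idealrBE yb_ideal p q); split; first by move/eqP.
by move/eqP.
Qed.

Lemma yb_piB : zmod_morphism yb_pi.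
Proof. by move=> p q; rewrite /yb_pi; rewrite !piE. Qed.

HB.instance Definition _ :=
  GRing.isZmodMorphism.Build free_alg yb_algebra yb_pi yb_piB.

Definition yb_rep (a : yb_algebra) : free_alg :=
  repr (a : Quotient.quot yb_ideal).

Lemma yb_repK : cancel yb_rep yb_pi.
Proof. by move=> a; apply: reprK. Qed.

Lemma yb_algebra_ind (P : yb_algebra -> Prop) :
  (forall p, P (yb_pi p)) -> forall a, P a.
Proof. by move=> Ppi a; rewrite -[a]yb_repK. Qed.

Lemma yb_rep_pi p : yb_rep (yb_pi p) - p \in yb_ideal.
Proof. by apply/yb_piP; rewrite yb_repK. Qed.

Definition yb_one : yb_algebra := yb_pi 1.
Definition yb_mul (a b : yb_algebra) := yb_pi (yb_rep a * yb_rep b).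
Definition yb_scale (c : k) (a : yb_algebra) := yb_pi (c *: yb_rep a).

Lemma yb_mulE p q : yb_mul (yb_pi p) (yb_pi q) = yb_pi (p * q).
Proof.
apply/yb_piP; set p' := yb_rep _; set q' := yb_rep _.
have -> : p' * q' - p * q = (p' - p) * q' + p * (q' - q).
  by rewrite mulrBl mulrBr addrA subrK.
by apply: rpredD; [apply: yb_idealMr | apply: yb_idealMl]; apply: yb_rep_pi.
Qed.

Lemma yb_scaleE c p : yb_scale c (yb_pi p) = yb_pi (c *: p).
Proof.
apply/yb_piP; rewrite -scalerBr -[_ - _]mul1r scalerAl.
exact/yb_idealMl/yb_rep_pi.
Qed.

Lemma yb_mulA : associative yb_mul.
Proof.
elim/yb_algebra_ind=> p; elim/yb_algebra_ind=> q; elim/yb_algebra_ind=> t.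
by rewrite !yb_mulE mulrA.
Qed.

Lemma yb_mul1r : left_id yb_one yb_mul.
Proof. by elim/yb_algebra_ind=> p; rewrite yb_mulE mul1r. Qed.

Lemma yb_mulr1 : right_id yb_one yb_mul.
Proof. by elim/yb_algebra_ind=> p; rewrite yb_mulE mulr1. Qed.

Lemma yb_mulDl : left_distributive yb_mul +%R.
Proof.
elim/yb_algebra_ind=> p; elim/yb_algebra_ind=> q; elim/yb_algebra_ind=> t.
by rewrite -raddfD !yb_mulE -raddfD mulrDl.
Qed.

Lemma yb_mulDr : right_distributive yb_mul +%R.
Proof.
elim/yb_algebra_ind=> p; elim/yb_algebra_ind=> q; elim/yb_algebra_ind=> t.
by rewrite -raddfD !yb_mulE -raddfD mulrDr.
Qed.

Lemma yb_one_neq0 : yb_one != 0.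
Proof.
apply/eqP; rewrite -[0](raddf0 yb_pi) => /yb_piP; rewrite subr0.
case/asboolP=> t; pose aug (p : free_alg) := mcoeff (mone : {fmonom X}) p.
have augM p q : aug (p * q) = aug p * aug q by apply: rmorphM.
have augX x : aug (free_var x) = 0 by rewrite /aug mcoeffU fm1_eq1.
have augB p q p' q' : aug p = 0 -> aug p' = 0 -> aug (p * q - p' * q') = 0.
  have -> : aug (p * q - p' * q') = aug (p * q) - aug (p' * q').
    exact: raddfB.
  by rewrite (augM p q) (augM p' q') => -> ->; rewrite !mul0r subrr.
have aug_rel p : aug (yb_relation p) = 0 by apply: augB; apply: augX.
move/(congr1 aug); rewrite {2}/aug raddf_sum big1 => [|c _] /=.
  by move/eqP; rewrite /aug mcoeff1 eqxx oner_eq0.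
by rewrite -/(aug _) augM (augM c.1.1) aug_rel mulr0 mul0r.
Qed.

HB.instance Definition _ := GRing.Zmodule_isNzRing.Build yb_algebra
  yb_mulA yb_mul1r yb_mulr1 yb_mulDl yb_mulDr yb_one_neq0.

Lemma yb_scaleA c c' a : yb_scale c (yb_scale c' a) = yb_scale (c * c') a.
Proof. by elim/yb_algebra_ind: a => p; rewrite !yb_scaleE scalerA. Qed.

Lemma yb_scale1 : left_id 1 yb_scale.
Proof. by elim/yb_algebra_ind=> p; rewrite yb_scaleE scale1r. Qed.

Lemma yb_scaleDr : right_distributive yb_scale +%R.
Proof.
move=> c; elim/yb_algebra_ind=> p; elim/yb_algebra_ind=> q.
by rewrite -raddfD !yb_scaleE -raddfD scalerDr.
Qed.

Lemma yb_scaleDl a : {morph yb_scale^~ a : c c' / c + c'}.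
Proof.
elim/yb_algebra_ind: a => p c c'.
by rewrite !yb_scaleE -raddfD scalerDl.
Qed.

HB.instance Definition _ := GRing.Zmodule_isLmodule.Build k yb_algebra
  yb_scaleA yb_scale1 yb_scaleDr yb_scaleDl.

Lemma yb_scalerAl (c : k) (a b : yb_algebra) : c *: (a * b) = (c *: a) * b.
Proof.
elim/yb_algebra_ind: a => p; elim/yb_algebra_ind: b => q.
rewrite [LHS](congr1 (yb_scale c) (yb_mulE p q)) yb_scaleE scalerAl.
by rewrite -yb_mulE -yb_scaleE.
Qed.

HB.instance Definition _ := GRing.Lmodule_isLalgebra.Build k yb_algebra
  yb_scalerAl.

Lemma yb_scalerAr (c : k) (a b : yb_algebra) : c *: (a * b) = a * (c *: b).
Proof.
elim/yb_algebra_ind: a => p; elim/yb_algebra_ind: b => q.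
rewrite [LHS](congr1 (yb_scale c) (yb_mulE p q)) yb_scaleE free_alg_scalerAr.
by rewrite -yb_mulE -yb_scaleE.
Qed.

HB.instance Definition _ := GRing.LSemiAlgebra_isSemiAlgebra.Build k yb_algebra
  yb_scalerAr.

HB.instance Definition _ := GRing.isMonoidMorphism.Build free_alg yb_algebra
  yb_pi (conj (erefl _) (fun p q => esym (yb_mulE p q))).

HB.instance Definition _ := GRing.isScalable.Build k free_alg yb_algebra *:%R
  yb_pi (fun c p => esym (yb_scaleE c p)).

(* The component A_m: classes of linear combinations of words of length m. *)
Definition yb_homog (m : nat) : {pred yb_algebra} := fun a =>
  `[< exists2 p : free_alg, {in msupp p, forall w, fdeg w = m} & a = yb_pi p >].

(* The sum of the components A_(m * d). *)
Definition veronese_pred (d : nat) : {pred yb_algebra} := fun a =>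
  `[< exists N (c : nat -> yb_algebra),
        (forall m, c m \in yb_homog (m * d)) /\ a = \sum_(m < N) c m >].

Lemma yb_homog0 m : 0 \in yb_homog m.
Proof. by apply/asboolP; exists 0; rewrite ?raddf0 // msupp0. Qed.

Lemma yb_homogD m a b :
  a \in yb_homog m -> b \in yb_homog m -> a + b \in yb_homog m.
Proof.
move=> /asboolP[p hp ->] /asboolP[q hq ->]; apply/asboolP.
exists (p + q); last by rewrite raddfD.
move=> w /(fsubsetP (msuppD_le p q)); rewrite in_fsetU => /orP[]; [exact: hp|].
exact: hq.
Qed.

Lemma yb_homogZ m (c : k) a : a \in yb_homog m -> c *: a \in yb_homog m.
Proof.
move=> /asboolP[p hp ->]; apply/asboolP.
exists (c *: p); last by rewrite [RHS]linearZ.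
by move=> w /(fsubsetP (msuppZ_le c p)) /hp.
Qed.

Lemma yb_homogM m m' a b :
  a \in yb_homog m -> b \in yb_homog m' -> a * b \in yb_homog (m + m').
Proof.
move=> /asboolP[p hp ->] /asboolP[q hq ->]; apply/asboolP.
exists (p * q); last by rewrite rmorphM.
by move=> w /msuppM_le[w1 [w2 [/hp <- /hq <- ->]]]; rewrite fdegM.
Qed.

Variable d : nat.

Lemma veronese_homog m a : a \in yb_homog (m * d) -> a \in veronese_pred d.
Proof.
move=> ha; apply/asboolP; exists m.+1, (fun i => if i == m then a else 0).
split=> [i|]; first by case: eqP => [->|_] //; apply: yb_homog0.
rewrite big_ord_recr /= eqxx big1 ?add0r // => i _.
by rewrite ltn_eqF.
Qed.

Lemma veroneseD a b :
  a \in veronese_pred d -> b \in veronese_pred d -> a + b \in veronese_pred d.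
Proof.
move=> /asboolP[N [c [hc ->]]] /asboolP[N' [c' [hc' ->]]]; apply/asboolP.
exists (maxn N N'), (fun m => (if (m < N)%N then c m else 0) +
                             (if (m < N')%N then c' m else 0)).
split=> [m|].
  by apply: yb_homogD; case: ifP => // _; apply: yb_homog0.
rewrite big_split /= -!big_mkcond /=.
by rewrite (big_ord_widen _ _ (leq_maxl N N')) (big_ord_widen _ _ (leq_maxr N N')).
Qed.

Lemma veronese_sum (I : Type) (s : seq I) (F : I -> yb_algebra) :
  (forall i, F i \in veronese_pred d) -> \sum_(i <- s) F i \in veronese_pred d.
Proof.
move=> hF; elim/big_ind: _ => // [|a b]; last exact: veroneseD.
exact/(@veronese_homog 0)/yb_homog0.
Qed.

Lemma veroneseM a b :
  a \in veronese_pred d -> b \in veronese_pred d -> a * b \in veronese_pred d.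
Proof.
move=> /asboolP[N [c [hc ->]]] /asboolP[N' [c' [hc' ->]]].
rewrite mulr_suml; apply: veronese_sum => i.
rewrite mulr_sumr; apply: veronese_sum => j.
by apply: (@veronese_homog (i + j)); rewrite mulnDl; apply: yb_homogM.
Qed.

Lemma veroneseZ (c : k) a : a \in veronese_pred d -> c *: a \in veronese_pred d.
Proof.
move=> /asboolP[N [e [he ->]]]; rewrite scaler_sumr.
by apply: veronese_sum => i; apply/veronese_homog/yb_homogZ/he.
Qed.

Lemma veronese_subalg_closed : GRing.subsemialg_closed (veronese_pred d).
Proof.
split=> [||c a|a b].
- apply/(@veronese_homog 0)/asboolP; exists 1; last by rewrite [RHS]rmorph1.
  by move=> w; rewrite msuppU1 in_fset1 => /eqP ->; apply: fdeg1.
- split; last exact: veroneseD.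
  exact/(@veronese_homog 0)/yb_homog0.
- exact: veroneseZ.
- exact: veroneseM.
Qed.

End YangBaxterAlgebra.

Section VeroneseSubalgebra.
Variables (k : fieldType) (X : finType) (r : X * X -> X * X) (d : nat).

Definition veronese_subalg := {a : yb_algebra k r | veronese_pred d a}.

Definition veronese_val (a : veronese_subalg) : yb_algebra k r := sval a.

HB.instance Definition _ := [isSub of veronese_subalg for veronese_val].
HB.instance Definition _ := [Choice of veronese_subalg by <:].
HB.instance Definition _ := GRing.SubChoice_isSubAlgebra.Build
  k (yb_algebra k r) (@veronese_pred k X r d) veronese_subalg
  (@veronese_subalg_closed k X r d).

End VeroneseSubalgebra.

(* Main.v *)
Require Import Defs.
From HB Require Import structures.
From mathcomp Require Import all_boot all_algebra all_fingroup.
From mathcomp Require Import generic_quotient finmap boolp.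
From mathcomp.multinomials Require Import monalg.

Set Implicit Arguments.
Unset Strict Implicit.
Unset Printing Implicit Defensive.

Import GRing.Theory.
Local Open Scope ring_scope.

(** A Yang-Baxter algebra is the algebra k[S] of its associated monoid S: a
    noncommutative polynomial lies in the ideal of the relations exactly when
    its coefficients sum to zero over each congruence class of words
    ([yb_idealP]).

    For any solution s and any d, writing out each normal word of length d as
    a word in X is compatible with the relations of the d-Veronese solution
    rho, because (^a b)(a^b) = ab holds in S. This gives a monoid morphism
    from S(rho) to S ([veronese_monoid_map]) and an algebra morphism from the
    Yang-Baxter algebra of rho to that of s. A word of length m * d is
    congruent to a concatenation of m normal words, so when d > 0 the image is
    the Veronese subalgebra, degree by degree. Since the algebra morphism is
    the linear extension of the monoid morphism, it is injective as soon as
    the monoid morphism is ([veronese_isomorphism]). Matching of the degrees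
    is automatic: a preimage of a homogeneous element can be chosen
    homogeneous, and it is the only preimage.

    For a permutation idempotent solution xy = g(y) y for all x, so any letter
    that has a letter to its right may be changed at will, while the last
    letter never changes: a word is determined in S by its length and its last
    letter ([perm_idempotent_congP]). Hence a normal word of length d is
    determined by its last letter, which gives n of them; a^b = b, and the
    last letter of ^a b is obtained by applying f^d to that of b, so that rho
    is again permutation idempotent ([veronese_perm_idempotent]). The monoid
    morphism is injective because length and last letter of a word in the
    normal words can be read off from the word in X that it spells
    ([veronese_monoid_map_inj]). *)

(** * Linear extension of a map between bases *)

Section Pushforward.
Variables (k : fieldType).

Definition push (K L : choiceType) (h : K -> L) (p : {malg k[K]}) : {malg k[L]} :=
  \sum_(u <- msupp p) << p@_u *g h u >>.

Lemma pushEw (K L : choiceType) (h : K -> L) (E : {fset K}) p :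
  (msupp p `<=` E)%fset -> push h p = \sum_(u <- E) << p@_u *g h u >>.
Proof.
move=> le; rewrite /push (big_fset_incl _ le) //= => x _ /mcoeff_outdom ->.
exact: monalgU0.
Qed.

Lemma push_is_additive (K L : choiceType) (h : K -> L) : zmod_morphism (push h).
Proof.
move=> p q.
rewrite (pushEw h (msuppB_le p q)) (pushEw h (fsubsetUl (msupp p) (msupp q))).
rewrite (pushEw h (fsubsetUr (msupp p) (msupp q))) -sumrB.
by apply: eq_bigr => u _; rewrite mcoeffB monalgUB.
Qed.

HB.instance Definition _ (K L : choiceType) (h : K -> L) :=
  GRing.isZmodMorphism.Build {malg k[K]} {malg k[L]} (push h) (push_is_additive h).

Lemma pushZ (K L : choiceType) (h : K -> L) (c : k) p : push h (c *: p) = c *: push h p.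
Proof.
rewrite (pushEw h (msuppZ_le c p)) /push scaler_sumr; apply: eq_bigr => u _.
by apply/malgP=> v; rewrite [(c *: p)@_u]mcoeffZ mcoeffZ !mcoeffU mulrnAr.
Qed.

Lemma pushU (K L : choiceType) (h : K -> L) (c : k) u :
  push h << c *g u >> = << c *g h u >>.
Proof. by rewrite (pushEw h msuppU_le) big_seq_fset1 mcoeffUU. Qed.

Lemma push_comp (K L M : choiceType) (h : K -> L) (g : L -> M) p :
  push g (push h p) = push (g \o h) p.
Proof. by rewrite {2}/push raddf_sum; apply: eq_bigr => u _; rewrite /= pushU. Qed.

Lemma eq_push (K L : choiceType) (h g : K -> L) p : h =1 g -> push h p = push g p.
Proof. by move=> hg; apply: eq_bigr => u _; rewrite hg. Qed.

Lemma mcoeff_push_inj (K L : choiceType) (h : K -> L) p u :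
  injective h -> (push h p)@_(h u) = p@_u.
Proof.
move=> hI; rewrite {2}[p]monalgE /push !raddf_sum; apply: eq_bigr => v _.
by rewrite /= !mcoeffU (inj_eq hI).
Qed.

Lemma push_inj (K L : choiceType) (h : K -> L) p :
  injective h -> push h p = 0 -> p = 0.
Proof.
by move=> hI p0; apply/malgP=> u; rewrite -(mcoeff_push_inj p u hI) p0 !mcoeff0.
Qed.

Lemma msupp_push (K L : choiceType) (h : K -> L) p v :
  v \in msupp (push h p) -> exists2 u, u \in msupp p & v = h u.
Proof.
apply: contraPP => nv; apply/negP; rewrite -mcoeff_eq0 /push raddf_sum /=.
rewrite big_seq big1 // => u up; rewrite mcoeffU.
by case: eqP => // huv; case: nv; exists u.
Qed.

Lemma fmonom_eq (X : choiceType) (u v : {fmonom X}) : u = v :> seq X -> u = v.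
Proof. by move=> uv; apply/eqP; rewrite fmP uv. Qed.

Lemma malgUM (K : monomType) (c e : k) (u v : K) :
  << c *g u >> * << e *g v >> = << c * e *g mmul u v >> :> {malg k[K]}.
Proof. exact: fgmulUU. Qed.

Lemma pushM (X Y : choiceType) (h : {fmonom X} -> {fmonom Y}) :
  {morph h : u v / mmul u v >-> mmul u v} -> {morph push h : p q / p * q}.
Proof.
move=> hM p q; rewrite malgME raddf_sum /push mulr_suml; apply: eq_bigr => u _.
rewrite raddf_sum mulr_sumr; apply: eq_bigr => v _ /=.
by rewrite pushU hM malgUM.
Qed.

End Pushforward.

(** * The Yang-Baxter algebra as a monoid algebra *)

Section MonoidAlgebra.
Variables (k : fieldType) (X : finType) (r : X * X -> X * X).
Local Notation free_alg := {malg k[{fmonom X}]}.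

Lemma yb_pi_word (c : k) (u v : seq X) : word_cong r u v ->
  yb_pi r << c *g FMonom u >> = yb_pi r << c *g FMonom v >>.
Proof.
elim=> {u v} [//|u v _ -> //|u v w _ -> //|u v x y].
apply/yb_piP.
pose a : free_alg := << c *g FMonom u >>; pose b : free_alg := << FMonom v >>.
have E x1 y1 : << c *g FMonom (u ++ [:: x1; y1] ++ v) >> =
    a * (free_var k x1 * free_var k y1) * b.
  rewrite /a /b /free_var !malgUM !mulr1; congr << _ *g _ >>.
  by apply: fmonom_eq; rewrite !fmM !fmU -catA.
rewrite !E -mulrBl -mulrBr; apply/yb_idealMr/yb_idealMl/asboolP.
by exists [:: (1, (x, y), 1)]; rewrite big_seq1 /= mul1r mulr1.
Qed.

(** Replacing each monomial by a congruent one does not change the class of a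
    polynomial; used both to pass to chosen representatives and to write words
    as products of normal words. *)
Lemma yb_pi_push (h : {fmonom X} -> {fmonom X}) (p : free_alg) :
  {in msupp p, forall u : {fmonom X}, word_cong r (h u) u} ->
  yb_pi r (push h p) = yb_pi r p.
Proof.
move=> hP; rewrite {2}[p]monalgE /push !raddf_sum big_seq [RHS]big_seq.
by apply: eq_bigr => u /hP /(yb_pi_word p@_u); rewrite !fmK.
Qed.

Definition monom_class (u : {fmonom X}) : yb_monoid r := word_class r u.

(** The relations are differences of congruent words, which gives one
    direction. Conversely, replacing each word by the representative of its
    class changes [p] only modulo the ideal, and the result depends only on the
    coefficient sums over the classes. *)
Lemma yb_idealP (p : free_alg) : p \in yb_ideal r <-> push monom_class p = 0.
Proof.
split=> [/asboolP[t ->]|p0].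
  have monom_rel c (u : {fmonom X}) q e (v : {fmonom X}) :
      push monom_class (<< c *g u >> * yb_relation k r q * << e *g v >>) = 0.
    have monomE x y : push monom_class
        (<< c *g u >> * (free_var k x * free_var k y) * << e *g v >>) =
        << c * e *g word_class r (u ++ [:: x; y] ++ v) >>.
      by rewrite /free_var !malgUM !mulr1 pushU /monom_class !fmM !fmU -catA.
    rewrite /yb_relation mulrBr mulrBl raddfB.
    apply/eqP; rewrite subr_eq0; apply/eqP.
    rewrite [LHS]monomE [RHS]monomE; congr << _ *g _ >>.
    by apply/word_classP; case: q => x y; apply: word_cong_rel.
  rewrite raddf_sum big1 // => -[[a q] b] _.
  rewrite -[LHS]/(push monom_class (a * yb_relation k r q * b)).
  rewrite [a]monalgE -mulrA mulr_suml raddf_sum big1 // => u _.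
  rewrite mulrA [b]monalgE mulr_sumr raddf_sum big1 // => v _.
  exact: monom_rel.
rewrite -[p]subr0; apply/yb_piP; rewrite raddf0.
rewrite -(@yb_pi_push (fun u => FMonom (repr (monom_class u)))).
  by rewrite -(push_comp monom_class (fun a => FMonom (repr a))) p0 !raddf0.
by move=> u _; apply: word_cong_repr.
Qed.

End MonoidAlgebra.

(** * Actions computed on words *)

Section ActionsOnWords.
Variables (X : finType) (s : solution X) (A : monoid_actions s).

(** The axioms of [monoid_actions] determine the actions on words letter by
    letter: induct on the word acted upon for a single acting letter, then on
    the acting word. *)
Lemma monoid_actions_word a u :
  Defs.lact A (word_class s a) (word_class s u) = word_class s (wlact s a u) /\
  Defs.ract A (word_class s a) (word_class s u) = word_class s (wract s a u).
Proof.
have letter x v :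
    Defs.lact A (word_class s [:: x]) (word_class s v) = word_class s (wlact1 s x v) /\
    Defs.ract A (word_class s [:: x]) (word_class s v) = word_class s [:: wract1 s x v].
  elim: v x => [|y v IHv] x /=; first by rewrite !word_class1 lact_g1 ract_g1.
  rewrite -[y :: v]cat1s word_classM lact_M ract_actM lact_letter ract_letter.
  by have [-> ->] := IHv (s (x, y)).2; rewrite -word_classM.
elim: a => [|x a [IH1 IH2]] /=; first by rewrite !word_class1 lact_1g ract_1g.
rewrite -[x :: a]cat1s word_classM lact_actM ract_M IH1 IH2.
by have [-> ->] := letter x (wlact s a u); rewrite -word_classM.
Qed.

End ActionsOnWords.

(** * Normal words and the monoid of the Veronese solution *)

Section NormalWordFacts.
Variables (n : nat) (s : solution 'I_n) (d : nat).
Local Notation N := (normal_words s d).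

Lemma normal_word_class_inj : injective (@normal_word_class n s d).
Proof.
move=> a b ab; apply/val_inj/val_inj; rewrite /=.
by rewrite -(Nor_unique (valP a)) -(Nor_unique (valP b)); congr Nor.
Qed.

Lemma normal_wordK (a : yb_monoid s) (ad : yb_degree a = d) :
  normal_word_class (normal_word ad) = a.
Proof. exact: NorK. Qed.

Lemma veronese_map_class1 (p : N * N) :
  normal_word_class (veronese_map s d p).1 =
  word_class s (wlact s (val p.1) (val p.2)).
Proof.
rewrite normal_wordK.
by case: (monoid_actions_word (solution_actions s) (val p.1) (val p.2)).
Qed.

Lemma veronese_map_class2 (p : N * N) :
  normal_word_class (veronese_map s d p).2 =
  word_class s (wract s (val p.1) (val p.2)).
Proof.
rewrite normal_wordK.
by case: (monoid_actions_word (solution_actions s) (val p.1) (val p.2)).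
Qed.

Definition veronese_word (w : seq N) : seq 'I_n :=
  flatten [seq tval (val a) | a <- w].

Lemma veronese_word_cat w w' :
  veronese_word (w ++ w') = veronese_word w ++ veronese_word w'.
Proof. by rewrite /veronese_word map_cat flatten_cat. Qed.

Lemma size_veronese_word w : size (veronese_word w) = (size w * d)%N.
Proof. by elim: w => //= a w IHw; rewrite size_cat IHw size_tuple mulSn. Qed.

(** A defining relation of the Veronese solution spells the identity
    (^a b)(a^b) = ab of the associated monoid. *)
Lemma veronese_word_cong w w' :
  word_cong (veronese_map s d) w w' ->
  word_cong s (veronese_word w) (veronese_word w').
Proof.
elim=> {w w'} [w|w w' _|w w' w'' _ IH1 _ IH2|w w' a b].
- exact: word_cong_refl.
- exact: word_cong_sym.
- exact: word_cong_trans IH1 IH2.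
rewrite !veronese_word_cat; apply/word_cong_catl/word_cong_catr/word_cong_sym.
apply/word_classP; rewrite /veronese_word /= !cats0 !word_classM.
apply: etrans (lact_ract (solution_actions s) (normal_word_class a)
                         (normal_word_class b)).
congr (_ * _)%g; exact: NorK.
Qed.

(** Cut [u] into blocks of length [d] and replace each block by its normal
    form. *)
Lemma veronese_word_surj m (u : seq 'I_n) : size u = (m * d)%N ->
  exists w, word_cong s (veronese_word w) u.
Proof.
elim: m u => [|m IHm] u su.
  by rewrite (size0nil su); exists [::]; apply: word_cong_refl.
have [|w wu] := IHm (drop d u); first by rewrite size_drop su mulSn addKn.
have td : yb_degree (word_class s (take d u)) = d.
  by rewrite yb_degree_class size_takel // su mulSn leq_addr.
exists (normal_word td :: w); rewrite -{2}(cat_take_drop d u).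
by apply: word_cong_cat wu; apply/word_classP; apply: (normal_wordK td).
Qed.

Definition veronese_monoid_map (a : yb_monoid (veronese_map s d)) : yb_monoid s :=
  word_class s (veronese_word (repr a)).

Lemma veronese_monoid_mapE w :
  veronese_monoid_map (word_class _ w) = word_class s (veronese_word w).
Proof. by apply/word_classP/veronese_word_cong/word_cong_repr. Qed.

End NormalWordFacts.

(** * From the Yang-Baxter algebra of the Veronese solution to the subalgebra *)

Section VeroneseMorphism.
Variables (k : fieldType) (n : nat) (s : solution 'I_n) (d : nat).
Local Notation N := (normal_words s d).
Local Notation rho := (veronese_map s d).
Local Notation B := (yb_algebra k rho).

Definition veronese_monom (w : {fmonom N}) : {fmonom 'I_n} :=
  FMonom (veronese_word w).

Definition veronese_sub (p : {malg k[{fmonom N}]}) : {malg k[{fmonom 'I_n}]} :=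
  push veronese_monom p.

Lemma veronese_subM : {morph veronese_sub : p q / p * q}.
Proof.
by apply: pushM => u v; apply: fmonom_eq; rewrite /= !fmM veronese_word_cat.
Qed.

Lemma veronese_sub1 : veronese_sub 1 = 1.
Proof.
by rewrite /veronese_sub pushU; congr << _ >>; apply: fmonom_eq; rewrite /= !fm1.
Qed.

(** Through this factorization the substitution respects the ideals, and it is
    injective modulo them as soon as the map of monoids is. *)
Lemma push_class_veronese_sub p :
  push (@monom_class _ s) (veronese_sub p) =
  push (@veronese_monoid_map n s d) (push (@monom_class _ rho) p).
Proof.
by rewrite !push_comp; apply: eq_push => w /=; rewrite veronese_monoid_mapE.
Qed.

Lemma veronese_sub_ideal p :
  p \in yb_ideal rho -> veronese_sub p \in yb_ideal s.
Proof.
by move=> /yb_idealP p0; apply/yb_idealP; rewrite push_class_veronese_sub p0 raddf0.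
Qed.

(** The substitution, passed to the quotient by means of the representative
    [yb_rep a]; [veronese_funE] shows that any other one gives the same value. *)
Definition veronese_fun (a : B) : yb_algebra k s := yb_pi s (veronese_sub (yb_rep a)).

Lemma veronese_funE p : veronese_fun (yb_pi rho p) = yb_pi s (veronese_sub p).
Proof.
by apply/yb_piP; rewrite -raddfB; apply/veronese_sub_ideal/yb_rep_pi.
Qed.

Lemma veronese_fun_homog m a :
  a \in yb_homog m -> veronese_fun a \in yb_homog (m * d).
Proof.
move=> /asboolP[p hp ->]; apply/asboolP; rewrite veronese_funE.
exists (veronese_sub p) => // u /msupp_push[w /hp <- ->].
by rewrite !fdegE /= size_veronese_word.
Qed.

Lemma veronese_fun_pred a : veronese_pred d (veronese_fun a).
Proof.
elim/yb_algebra_ind: a => p; rewrite veronese_funE /veronese_sub /push raddf_sum.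
apply: (@veronese_sum k _ s d) => w /=.
apply/(@veronese_homog k _ s d (fdeg w))/asboolP; eexists; last by reflexivity.
move=> u /(fsubsetP msuppU_le); rewrite in_fset1 => /eqP ->.
by rewrite !fdegE /= size_veronese_word.
Qed.

Definition veronese_morphism (a : B) : veronese_subalg k s d :=
  exist _ (veronese_fun a) (veronese_fun_pred a).

Lemma veronese_morphismB : zmod_morphism veronese_morphism.
Proof.
elim/yb_algebra_ind=> p; elim/yb_algebra_ind=> q; apply/val_inj.
by rewrite [RHS]raddfB /= -raddfB !veronese_funE /veronese_sub !raddfB.
Qed.

Lemma veronese_morphismM : monoid_morphism veronese_morphism.
Proof.
split.
  apply/val_inj; rewrite [RHS]rmorph1 /= -(rmorph1 (yb_pi rho)).
  by rewrite veronese_funE veronese_sub1 rmorph1.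
elim/yb_algebra_ind=> p; elim/yb_algebra_ind=> q; apply/val_inj.
by rewrite [RHS]rmorphM /= -rmorphM !veronese_funE veronese_subM rmorphM.
Qed.

Lemma veronese_morphismZ : scalable veronese_morphism.
Proof.
move=> c; elim/yb_algebra_ind=> p; apply/val_inj.
by rewrite [RHS]linearZ /= -linearZ !veronese_funE /veronese_sub pushZ linearZ.
Qed.

HB.instance Definition _ := GRing.isZmodMorphism.Build B (veronese_subalg k s d)
  veronese_morphism veronese_morphismB.
HB.instance Definition _ := GRing.isMonoidMorphism.Build B (veronese_subalg k s d)
  veronese_morphism veronese_morphismM.
HB.instance Definition _ := GRing.isScalable.Build k B (veronese_subalg k s d) *:%R
  veronese_morphism veronese_morphismZ.

Hypothesis d_gt0 : (0 < d)%N.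

Lemma veronese_fun_surj_homog m b : b \in yb_homog (m * d) ->
  exists2 a, a \in yb_homog m & b = veronese_fun a.
Proof.
move=> /asboolP[p hp ->].
(* [t] rewrites every word of length m * d over normal words; its values on
   other words are arbitrary. *)
have /choice[t tP] (u : {fmonom 'I_n}) : exists w : {fmonom N},
    fdeg u = (m * d)%N -> word_cong s (veronese_monom w) u.
  have [su|] := EM (fdeg u = (m * d)%N); last by exists (FMonom [::]).
  by have [w wu] := veronese_word_surj s su; exists (FMonom w).
exists (yb_pi rho (push t p)).
  apply/asboolP; exists (push t p) => // w /msupp_push[u up ->].
  have /word_cong_size := tP _ (hp _ up).
  rewrite size_veronese_word -(fdegE u) (hp _ up) => /eqP.
  by rewrite eqn_pmul2r // => /eqP.
rewrite veronese_funE /veronese_sub push_comp yb_pi_push // => u up.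
exact/tP/hp.
Qed.

Lemma veronese_morphism_surj b : exists a, veronese_morphism a = b.
Proof.
case: b => b bP; have /asboolP[M [c [cP bE]]] := bP.
have /choice[a aP] m : exists a : B, c m = veronese_fun a.
  by have [a _ cE] := veronese_fun_surj_homog (cP m); exists a.
exists (\sum_(m < M) a m); apply/val_inj; rewrite raddf_sum raddf_sum /=.
by rewrite bE; apply: eq_bigr => m _; rewrite aP.
Qed.

Hypothesis map_inj : injective (@veronese_monoid_map n s d).

Lemma veronese_morphism_inj : injective veronese_morphism.
Proof.
apply: raddf_inj; elim/yb_algebra_ind=> p /(congr1 val) /=.
rewrite veronese_funE -(raddf0 (yb_pi rho)) -(raddf0 (yb_pi s)).
move=> /yb_piP; rewrite subr0 => /yb_idealP; rewrite push_class_veronese_sub.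
by move=> /(push_inj map_inj) p0; apply/yb_piP; rewrite subr0; apply/yb_idealP.
Qed.

(** Degrees are reflected because a homogeneous value has a homogeneous
    preimage, which by injectivity is the only preimage. *)
Theorem veronese_isomorphism :
  exists2 phi : {lrmorphism B -> veronese_subalg k s d}, bijective phi &
    forall (m : nat) (a : B),
      (a \in yb_homog m) = (veronese_val (phi a) \in yb_homog (m * d)).
Proof.
exists veronese_morphism => [|m a].
  have [g gK] := choice veronese_morphism_surj; exists g => // a.
  by apply: veronese_morphism_inj; rewrite gK.
apply/idP/idP => [|/veronese_fun_surj_homog[a' a'm aa']].
  exact: veronese_fun_homog.
suff -> : a = a' by [].
exact/veronese_morphism_inj/val_inj.
Qed.

End VeroneseMorphism.

(** * Words modulo the relations of a permutation idempotent solution *)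

Section PermIdempotentMonoid.
Variables (X : finType) (g : {perm X}) (r : X * X -> X * X).
Hypothesis rE : r =1 perm_idempotent_map g.

(** Since x z = g(z) z for every x, all the letters but the last can be changed
    freely, and no relation alters the last letter. The default [x0] matters
    only for empty words, where both values are [x0]. *)
Lemma perm_idempotent_congP x0 u v :
  word_cong r u v <-> size u = size v /\ last x0 u = last x0 v.
Proof.
split=> [uv|].
  split; first exact: word_cong_size uv.
  elim: uv => {u v} [//|u v _ -> //|u v w _ -> //|u v x y].
  by rewrite !last_cat rE.
have head x y z t : word_cong r (x :: z :: t) (y :: z :: t).
  have step x' : word_cong r (x' :: z :: t) (g z :: z :: t).
    by have := word_cong_rel r [::] t x' z; rewrite rE.
  by apply: word_cong_trans (step x) _; apply/word_cong_sym/step.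
elim: u v x0 => [|x u IHu] [|y v] x0 //= [] //.
- by move=> _ _; apply: word_cong_refl.
- move=> /eqP; rewrite eqSS => /eqP; case: u v IHu => [|z u] [|t v] IHu //= suv uv.
    by rewrite uv; apply: word_cong_refl.
  apply: word_cong_trans (head x y z u) _; apply: (word_cong_catl [:: y]).
  by apply: (IHu (t :: v) x).
Qed.

End PermIdempotentMonoid.

(** * The Veronese solution of a permutation idempotent solution *)

Section PermIdempotentVeronese.
Variables (n : nat) (f : {perm 'I_n}).
Local Notation s := (perm_idempotent_solution f).

Lemma wlact_perm_idempotent a u : wlact s a u = [seq iter (size a) f x | x <- u].
Proof.
have wlact1E x w : wlact1 s x w = [seq f y | y <- w].
  by elim: w x => //= y w IHw x; rewrite IHw.
elim: a => [|x a IHa]; first by rewrite map_id_in.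
by rewrite -[LHS]/(wlact1 s x (wlact s a u)) wlact1E IHa -map_comp.
Qed.

Lemma last_wract_perm_idempotent x0 a u : (0 < size a)%N -> (0 < size u)%N ->
  last x0 (wract s a u) = last x0 u.
Proof.
have wract1E x w : wract1 s x w = last x w by elim: w x => //= y w IHw x.
case: u => // y u; elim: a x0 => // x [|x' a] IHa x0 _ _; last exact: IHa.
exact: wract1E.
Qed.

Variable d : nat.
Hypothesis d_gt0 : (0 < d)%N.
Variable x0 : 'I_n.
Local Notation N := (normal_words s d).
Local Notation rho := (veronese_map s d).

Definition last_letter (a : N) : 'I_n := last x0 (val a).

Lemma normal_class_last (a : N) (w : seq 'I_n) : size w = d ->
  normal_word_class a = word_class s w <-> last_letter a = last x0 w.
Proof.
move=> sw; split=> [/word_classP/(perm_idempotent_congP (frefl _) x0)[] //|aw].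
apply/word_classP/(perm_idempotent_congP (frefl _) x0); split=> //.
by rewrite size_tuple.
Qed.

Lemma last_letter_inj : injective last_letter.
Proof.
move=> a b ab; apply/normal_word_class_inj/normal_class_last => //.
exact: size_tuple.
Qed.

Lemma card_normal_words : #|N| = n.
Proof.
pose nw q := normal_word (etrans (yb_degree_class s (nseq d q)) (size_nseq d q)).
have nwE q : last_letter (nw q) = q.
  have last_nseq : last x0 (nseq d q) = q by case: (d) d_gt0 => // m _; elim: m.
  rewrite -[RHS]last_nseq; apply/normal_class_last; first exact: size_nseq.
  exact: normal_wordK.
rewrite -[RHS]card_ord; apply: (@bij_eq_card _ _ last_letter).
by exists nw => // a; apply: last_letter_inj; rewrite nwE.
Qed.

Lemma veronese_map_2 p : (rho p).2 = p.2.
Proof.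
apply/last_letter_inj/(normal_class_last _ (size_tuple _)).
rewrite veronese_map_class2.
apply/word_classP/(perm_idempotent_congP (frefl _) x0).
by rewrite size_wract !size_tuple last_wract_perm_idempotent ?size_tuple.
Qed.

Lemma last_veronese_map_1 p : last_letter (rho p).1 = iter d f (last_letter p.2).
Proof.
have -> : iter d f (last_letter p.2) = last x0 [seq iter d f x | x <- val p.2].
  have : (0 < size (val p.2))%N by rewrite size_tuple.
  by rewrite /last_letter; case: (tval (val p.2)) => //= x u _; rewrite last_map.
apply/normal_class_last; first by rewrite size_map size_tuple.
by rewrite veronese_map_class1 wlact_perm_idempotent size_tuple.
Qed.

Lemma veronese_perm_idempotent : is_perm_idempotent rho.
Proof.
have gI : injective (fun b : N => (rho (b, b)).1).
  move=> a b /(congr1 last_letter); rewrite !last_veronese_map_1 /= => ab.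
  apply: last_letter_inj; elim: (d) ab => // m IHm /= /perm_inj; exact: IHm.
exists (perm gI) => p; rewrite [LHS]surjective_pairing veronese_map_2.
rewrite /perm_idempotent_map permE; congr pair; apply: last_letter_inj.
by rewrite !last_veronese_map_1.
Qed.

(** Length and last letter separate the elements of both monoids; spelling out
    a word in the normal words multiplies its length by [d] and keeps the last
    letter of its last factor, which identifies that factor. *)
Lemma veronese_monoid_map_inj : injective (@veronese_monoid_map n s d).
Proof.
have [g rhoE] := veronese_perm_idempotent.
move=> c e; rewrite -[c]word_class_repr -[e]word_class_repr.
move: (repr c) (repr e) => w w'.
rewrite !veronese_monoid_mapE => /word_classP.
move=> /(perm_idempotent_congP (frefl _) x0); rewrite !size_veronese_word.
case=> /eqP; rewrite eqn_pmul2r // => /eqP sw lw; apply/word_classP.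
have lastE w1 a : last x0 (veronese_word (rcons w1 a)) = last_letter a.
  rewrite -cats1 veronese_word_cat last_cat /veronese_word /= cats0 /last_letter.
  have : (0 < size (val a))%N by rewrite size_tuple.
  by case: (tval (val a)).
case/lastP: w w' sw lw => [|w a] w'; case/lastP: w' => [|w' b];
  rewrite ?size_rcons // => sw lw; first exact: word_cong_refl.
apply/(perm_idempotent_congP rhoE a); rewrite !size_rcons !last_rcons; split=> //.
by apply: last_letter_inj; rewrite -(lastE w a) -(lastE w' b).
Qed.

End PermIdempotentVeronese.

Theorem corollary6p13 (k : fieldType) (n : nat) (hn : (2 <= n)%N)
    (f : {perm 'I_n}) (d : nat) (hd : (2 <= d)%N) :
  let X_rf := perm_idempotent_solution f in
  let rho_d := veronese_map X_rf d in
  [/\ exists2 phi : {lrmorphism yb_algebra k rho_d -> veronese_subalg k X_rf d},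
        bijective phi &
        forall (m : nat) (a : yb_algebra k rho_d),
          (a \in yb_homog m) = (veronese_val (phi a) \in yb_homog (m * d)),
      is_perm_idempotent rho_d
    & #|normal_words X_rf d| = n].
Proof.
have d_gt0 := ltnW hd; pose x0 : 'I_n := Ordinal (ltnW hn).
split.
- exact: (veronese_isomorphism k d_gt0 (veronese_monoid_map_inj d_gt0 x0)).
- exact: veronese_perm_idempotent d_gt0 x0.
- exact: card_normal_words d_gt0 x0.
Qed.
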